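(* Let $F$ be an algebraically closed field of characteristic $0$ and let $J$ be the Jordan algebra of type D over $F$. Then the derivation algebra $\mathrm{Der}(J)$ is simple.
   Context: A Jordan algebra over a field $F$ is an $F$-algebra $J$ with product $\circ$ such that $x\circ y = y\circ x$ and $(x^2\circ y)\circ x = x^2\circ(x\circ y)$ for all $x,y\in J$, where $x^2 = x\circ x$. A derivation of $J$ is a linear map $D:J\to J$ with $D(x\circ y) = D(x)\circ y + x\circ D(y)$; $\mathrm{Der}(J)$ is the Lie algebra of all derivations under the commutator bracket. The Jordan algebra of type D is the exceptional simple Jordan algebra (corresponding to the system $M_3^8$ in Albert's notation), of dimension $27$ over its center. Over an algebraically closed field $F$ of characteristic $0$ it is the $27$-dimensional algebra of $3\times3$ Hermitian matrices (equal to their conjugate transpose) with entries in the octonion algebra $\mathbb{O}$ over $F$, with product $x\circ y=\frac12(xy+yx)$. *)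

(* Defs.v *)
From HB Require Import structures.
From mathcomp Require Import all_boot all_order all_algebra.

Set Implicit Arguments.
Unset Strict Implicit.
Unset Printing Implicit Defensive.

Import GRing.Theory.
Local Open Scope ring_scope.

(* Neither associativity, nor commutativity, nor a unit is required. *)
Record nalg (F : fieldType) := NAlg {
  nalg_sort :> vectType F;
  nmul : nalg_sort -> nalg_sort -> nalg_sort;
  nmul_linearl : forall y, linear (nmul^~ y);
  nmul_linearr : forall x, linear (nmul x)
}.

Arguments nmul {F n} _ _.

Section NAlgTheory.
Variables (F : fieldType) (A : nalg F).
Implicit Types (x y z : A) (a : F).

Lemma nmulDl x y z : nmul (x + y) z = nmul x z + nmul y z.
Proof. by have := nmul_linearl z 1 x y; rewrite !scale1r. Qed.

Lemma nmulDr x y z : nmul x (y + z) = nmul x y + nmul x z.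
Proof. by have := nmul_linearr x 1 y z; rewrite !scale1r. Qed.

Lemma nmul0l x : nmul 0 x = 0.
Proof. by apply: (addrI (nmul 0 x)); rewrite -nmulDl !addr0. Qed.

Lemma nmul0r x : nmul x 0 = 0.
Proof. by apply: (addrI (nmul x 0)); rewrite -nmulDr !addr0. Qed.

Lemma nmulZl a x y : nmul (a *: x) y = a *: nmul x y.
Proof. by have := nmul_linearl y a x 0; rewrite nmul0l !addr0. Qed.

Lemma nmulZr a x y : nmul x (a *: y) = a *: nmul x y.
Proof. by have := nmul_linearr x a y 0; rewrite nmul0r !addr0. Qed.

Lemma nmulNl x y : nmul (- x) y = - nmul x y.
Proof. by rewrite -scaleN1r nmulZl scaleN1r. Qed.

Lemma nmulNr x y : nmul x (- y) = - nmul x y.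
Proof. by rewrite -scaleN1r nmulZr scaleN1r. Qed.

Lemma nmul_suml (I : finType) (f : I -> A) y :
  nmul (\sum_i f i) y = \sum_i nmul (f i) y.
Proof.
by apply: (big_morph (nmul^~ y)) => [u v|]; rewrite ?nmulDl ?nmul0l.
Qed.

Lemma nmul_sumr (I : finType) (f : I -> A) x :
  nmul x (\sum_i f i) = \sum_i nmul x (f i).
Proof.
by apply: (big_morph (nmul x)) => [u v|]; rewrite ?nmulDr ?nmul0r.
Qed.

End NAlgTheory.

(* Algebras with an involution, i.e. a linear anti-automorphism of order 2. *)
Record invalg (F : fieldType) := InvAlg {
  invalg_nalg :> nalg F;
  star : invalg_nalg -> invalg_nalg;
  star_linear : linear star;
  starK : involutive star;
  starM : forall x y, star (nmul x y) = nmul (star y) (star x)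
}.

Arguments star {F i} _.

Section InvAlgTheory.
Variables (F : fieldType) (A : invalg F).
Implicit Types (x y : A) (a : F).

Lemma starD x y : star (x + y) = star x + star y.
Proof. by have := star_linear 1 x y; rewrite !scale1r. Qed.

Lemma star0 : star (0 : A) = 0.
Proof. by apply: (addrI (star (0 : A))); rewrite -starD !addr0. Qed.

Lemma starZ a x : star (a *: x) = a *: star x.
Proof. by have := star_linear a x 0; rewrite star0 !addr0. Qed.

Lemma starN x : star (- x) = - star x.
Proof. by rewrite -scaleN1r starZ scaleN1r. Qed.

Lemma star_sum (I : finType) (f : I -> A) :
  star (\sum_i f i) = \sum_i star (f i).
Proof. by apply: (big_morph star) => [u v|]; rewrite ?starD ?star0. Qed.

End InvAlgTheory.

Section BaseField.
Variable F : fieldType.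

Fact scalar_linearl (y : F^o) : linear (fun x : F^o => x * y : F^o).
Proof. by move=> a u v; rewrite mulrDl scalerAl. Qed.

Fact scalar_linearr (x : F^o) : linear (fun y : F^o => x * y : F^o).
Proof. by move=> a u v; rewrite mulrDr scalerAr. Qed.

Definition scalar_nalg : nalg F := NAlg scalar_linearl scalar_linearr.

Fact id_linear : linear (id : scalar_nalg -> scalar_nalg).
Proof. by []. Qed.

Fact id_invol : involutive (id : scalar_nalg -> scalar_nalg).
Proof. by []. Qed.

Fact id_anti (x y : scalar_nalg) : id (nmul x y) = nmul (id y) (id x).
Proof. exact: mulrC. Qed.

Definition scalar_invalg : invalg F := InvAlg id_linear id_invol id_anti.

End BaseField.

Section CayleyDickson.
Variables (F : fieldType) (A : invalg F).

Definition cd_mul (x y : A * A) : A * A :=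
  (nmul x.1 y.1 - nmul (star y.2) x.2, nmul y.2 x.1 + nmul x.2 (star y.1)).

Definition cd_star (x : A * A) : A * A := (star x.1, - x.2).

Fact cd_mul_linearl y : linear (cd_mul^~ y).
Proof.
move=> a u v; congr (_, _) => /=.
  by rewrite !nmulDl !nmulDr !nmulZl !nmulZr scalerBr opprD addrACA.
by rewrite !nmulDl !nmulDr !nmulZl !nmulZr scalerDr addrACA.
Qed.

Fact cd_mul_linearr x : linear (cd_mul x).
Proof.
move=> a u v; congr (_, _) => /=.
  by rewrite starD starZ !nmulDl !nmulDr !nmulZl !nmulZr scalerBr opprD addrACA.
by rewrite starD starZ !nmulDl !nmulDr !nmulZl !nmulZr scalerDr addrACA.
Qed.

Definition cd_nalg : nalg F := NAlg cd_mul_linearl cd_mul_linearr.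

Fact cd_star_linear : linear (cd_star : cd_nalg -> cd_nalg).
Proof.
move=> a u v; congr (_, _) => /=; first by rewrite starD starZ.
by rewrite opprD scalerN.
Qed.

Fact cd_starK : involutive (cd_star : cd_nalg -> cd_nalg).
Proof. by case=> x y; rewrite /cd_star /= starK opprK. Qed.

Fact cd_starM (x y : cd_nalg) :
  cd_star (nmul x y) = nmul (cd_star y : cd_nalg) (cd_star x).
Proof.
congr (_, _) => /=.
  by rewrite starD starN !starM starK starN nmulNl nmulNr opprK.
by rewrite starK !nmulNl opprD addrC.
Qed.

Definition cayley_dickson : invalg F :=
  InvAlg cd_star_linear cd_starK cd_starM.

End CayleyDickson.

(* Every parameter of the three doublings is -1; over an algebraically closed
   field every octonion algebra is isomorphic to this one. *)
Definition octonion (F : fieldType) : invalg F :=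
  cayley_dickson (cayley_dickson (cayley_dickson (scalar_invalg F))).

Section HermitianJordan.
Variables (F : fieldType) (n : nat) (A : invalg F).

(* The library's vector space structure on 'M_n exists only for coefficients in
   a ring, hence finite functions: the entry in row i, column j of x is
   x (i, j). *)
Definition nmx : vectType F := {ffun 'I_n * 'I_n -> A}.

Definition nmx_mul (x y : nmx) : nmx :=
  [ffun ij => \sum_k nmul (x (ij.1, k)) (y (k, ij.2))].

Definition conjtr (x : nmx) : nmx := [ffun ij => star (x (ij.2, ij.1))].

Definition anti_herm_part (x : nmx) : nmx := x - conjtr x.

Fact anti_herm_part_linear : linear anti_herm_part.
Proof.
move=> a x y; apply/ffunP=> ij; rewrite !ffunE starD starZ scalerBr opprD.
by rewrite addrACA.
Qed.
HB.instance Definition _ :=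
  GRing.isLinear.Build F nmx nmx _ anti_herm_part anti_herm_part_linear.

Definition hermitian : {vspace nmx} := lker (linfun anti_herm_part).

Lemma mem_hermitian (x : nmx) : (x \in hermitian) = (conjtr x == x).
Proof. by rewrite memv_ker lfunE /= subr_eq0 eq_sym. Qed.

Definition jordan_mul (x y : nmx) : nmx :=
  2%:R^-1 *: (nmx_mul x y + nmx_mul y x).

Lemma conjtr_nmx_mul x y : conjtr (nmx_mul x y) = nmx_mul (conjtr y) (conjtr x).
Proof.
apply/ffunP=> ij; rewrite !ffunE star_sum; apply: eq_bigr => k _.
by rewrite !ffunE starM.
Qed.

Lemma conjtr_jordan_mul x y :
  conjtr (jordan_mul x y) = jordan_mul (conjtr x) (conjtr y).
Proof.
rewrite /jordan_mul addrC -!conjtr_nmx_mul; apply/ffunP=> ij.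
by rewrite !ffunE starZ starD.
Qed.

Lemma jordan_mul_hermitian x y :
  x \in hermitian -> y \in hermitian -> jordan_mul x y \in hermitian.
Proof.
by rewrite !mem_hermitian conjtr_jordan_mul => /eqP-> /eqP->.
Qed.

Definition herm_mul (x y : subvs_of hermitian) : subvs_of hermitian :=
  Subvs (jordan_mul_hermitian (subvsP x) (subvsP y)).

Lemma jordan_mulC x y : jordan_mul x y = jordan_mul y x.
Proof. by rewrite /jordan_mul addrC. Qed.

Fact jordan_mul_linearr x : linear (jordan_mul x).
Proof.
move=> a u v; rewrite /jordan_mul scalerA mulrC -scalerA -scalerDr.
congr (_ *: _); apply/ffunP=> ij; rewrite !ffunE -!big_split /= scaler_sumr.
rewrite -big_split; apply: eq_bigr => k _ /=.
by rewrite !ffunE nmulDl nmulDr nmulZl nmulZr scalerDr addrACA.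
Qed.

Fact herm_mul_linearr x : linear (herm_mul x).
Proof. by move=> a u v; apply/val_inj/jordan_mul_linearr. Qed.

Fact herm_mul_linearl y : linear (herm_mul^~ y).
Proof.
have mulC u : herm_mul u y = herm_mul y u by apply/val_inj/jordan_mulC.
by move=> a u v; rewrite !mulC herm_mul_linearr.
Qed.

Definition hermitian_jordan : nalg F := NAlg herm_mul_linearl herm_mul_linearr.

End HermitianJordan.

Definition jordan_type_D (F : fieldType) : nalg F :=
  hermitian_jordan 3 (octonion F).

Record lieAlg (F : fieldType) := LieAlg {
  lie_sort :> vectType F;
  bracket : lie_sort -> lie_sort -> lie_sort;
  bracket_linearl : forall y, linear (bracket^~ y);
  bracket_linearr : forall x, linear (bracket x);
  bracket_alt : forall x, bracket x x = 0;
  bracket_jacobi : forall x y z,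
    bracket x (bracket y z) + bracket y (bracket z x)
      + bracket z (bracket x y) = 0
}.

Arguments bracket {F l} _ _.

Definition lie_ideal (F : fieldType) (L : lieAlg F) (I : {vspace L}) : Prop :=
  forall x y : L, y \in I -> bracket x y \in I.

Definition lie_simple (F : fieldType) (L : lieAlg F) : Prop :=
  (exists x y : L, bracket x y != 0) /\
  (forall I : {vspace L}, lie_ideal I -> I = 0%VS \/ I = fullv).

Section Derivations.
Variables (F : fieldType) (J : nalg F).

Definition is_derivation (D : 'End(J)) : Prop :=
  forall x y, D (nmul x y) = nmul (D x) y + nmul x (D y).

Definition leibniz_defect (x y : J) (D : 'End(J)) : J :=
  D (nmul x y) - (nmul (D x) y + nmul x (D y)).

Fact leibniz_defect_linear x y : linear (leibniz_defect x y).
Proof.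
move=> a D E; rewrite /leibniz_defect !lfunE /= !lfunE /=.
rewrite nmulDl nmulDr nmulZl nmulZr addrACA -scalerDr opprD addrACA.
by rewrite scalerBr.
Qed.
HB.instance Definition _ x y :=
  GRing.isLinear.Build F 'End(J) J _ (leibniz_defect x y)
    (leibniz_defect_linear x y).

(* The Leibniz rule is imposed on a basis only, so that the intersection is
   finite; see derP. *)
Definition der : {vspace 'End(J)} :=
  (\bigcap_(ij : 'I_(\dim {:J}) * 'I_(\dim {:J}))
     lker (linfun (leibniz_defect (vbasis {:J})`_ij.1 (vbasis {:J})`_ij.2)))%VS.

Lemma derP (D : 'End(J)) : reflect (is_derivation D) (D \in der).
Proof.
rewrite memvE; apply: (iffP subv_bigcapP) => [derD x y | derD ij _]; last first.
  by rewrite -memvE memv_ker lfunE /= /leibniz_defect derD subrr.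
rewrite (coord_vbasis (memvf x)) (coord_vbasis (memvf y)).
rewrite !linear_sum /= !nmul_suml !linear_sum -big_split; apply: eq_bigr => i _.
rewrite !nmul_sumr !linear_sum -big_split; apply: eq_bigr => j _ /=.
rewrite !linearZ /= !nmulZl !nmulZr !linearZ /= -!scalerDr.
rewrite !scalerA mulrC; congr (_ *: _); apply/eqP; rewrite -subr_eq0.
by have := derD (i, j) isT; rewrite -memvE memv_ker lfunE.
Qed.

Definition commutator (D E : 'End(J)) : 'End(J) := ((D \o E) - (E \o D))%VF.

Lemma commutatorE D E x : commutator D E x = D (E x) - E (D x).
Proof. by rewrite /commutator add_lfunE opp_lfunE !comp_lfunE. Qed.

Lemma commutator_linearl E : linear (commutator^~ E).
Proof.
move=> a D D'; rewrite /commutator comp_lfunDl comp_lfunDr -comp_lfunZl.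
by rewrite -comp_lfunZr scalerBr opprD addrACA.
Qed.

Lemma commutatorC D E : commutator D E = - commutator E D.
Proof. by rewrite /commutator opprB. Qed.

Lemma commutator_linearr D : linear (commutator D).
Proof.
by move=> a E E'; rewrite !(commutatorC D) commutator_linearl opprD scalerN.
Qed.

Lemma commutator_alt D : commutator D D = 0.
Proof. exact: subrr. Qed.

Lemma commutator_jacobi D E G :
  commutator D (commutator E G) + commutator E (commutator G D)
    + commutator G (commutator D E) = 0.
Proof.
rewrite /commutator !(comp_lfunDl, comp_lfunDr, comp_lfunNl, comp_lfunNr).
rewrite !comp_lfunA.
set a := (D \o E \o G)%VF; set b := (D \o G \o E)%VF.
set c := (E \o G \o D)%VF; set d := (G \o E \o D)%VF.
set e := (E \o D \o G)%VF; set f := (G \o D \o E)%VF.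
rewrite 3!opprB [LHS](AC ((2*2)*2) ((1*(4*5))*((2*3)*6))) /=.
by rewrite !subrKA subrr.
Qed.

Lemma commutator_der D E : D \in der -> E \in der -> commutator D E \in der.
Proof.
move=> /derP derD /derP derE; apply/derP=> x y.
rewrite !commutatorE derE derD !linearD /= !derD !derE.
rewrite !(nmulDl, nmulDr, nmulNl, nmulNr).
set a := nmul (D _) y; set b := nmul (E x) _; set c := nmul (D x) _.
set d := nmul x (D _); set e := nmul _ y; set f := nmul x _.
rewrite [a + b + _](AC (2*2) ((1 * 4) * (2 * 3))) /=.
by rewrite -opprD [e + c + _](AC (2*2) ((3 * 2) * (1 * 4))) /= addrKA opprD addrACA.
Qed.

Definition der_bracket (D E : subvs_of der) : subvs_of der :=
  Subvs (commutator_der (subvsP D) (subvsP E)).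

Fact der_bracket_linearl E : linear (der_bracket^~ E).
Proof. by move=> a D D'; apply/val_inj/commutator_linearl. Qed.

Fact der_bracket_linearr D : linear (der_bracket D).
Proof. by move=> a E E'; apply/val_inj/commutator_linearr. Qed.

Fact der_bracket_alt D : der_bracket D D = 0.
Proof. exact/val_inj/commutator_alt. Qed.

Fact der_bracket_jacobi D E G :
  der_bracket D (der_bracket E G) + der_bracket E (der_bracket G D)
    + der_bracket G (der_bracket D E) = 0.
Proof. exact/val_inj/commutator_jacobi. Qed.

Definition Der : lieAlg F :=
  LieAlg der_bracket_linearl der_bracket_linearr der_bracket_alt
    der_bracket_jacobi.

End Derivations.

(* Main.v *)
From HB Require Import structures.
Require Import Defs.
From mathcomp Require Import all_boot all_algebra.
From mathcomp Require Import ring.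

Set Implicit Arguments.
Unset Strict Implicit.
Unset Printing Implicit Defensive.

Import GRing.Theory.
Local Open Scope ring_scope.

(* J is spanned by three orthogonal idempotents e_0, e_1, e_2 and three
   off-diagonal copies of the octonions, X_i(a) having a in position
   (i+1, i+2), indices mod 3. Commutation with the skew-Hermitian matrix having
   a in position (i+1, i+2) is a derivation R_i(a), a multiple of
   [L_(e_(i+1)), L_(X_i(a))], and Der(J) = D_0 + R_0(O) + R_1(O) + R_2(O) where
   D_0 is the annihilator of the idempotents. An element of D_0 acts on each
   X_i(O) by a skew map d_i, and, up to sign,
     [D, R_i(a)] = R_i(d_i a),   [R_i(a), R_(i+1)(b)] = R_(i+2)(conj(a b)),
     [[R_i(u), R_i(v)], R_i(w)] = 4 R_i(<u,w> v - <v,w> u).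
   Hence an ideal containing some R_i(u) with u <> 0 contains every R_j(v); it
   then contains D_0, because every skew d_0 comes from a sum of brackets
   [R_0(u), R_0(v)] and d_0 determines the element of D_0 (the nucleus of the
   octonions is reduced to scalars). In a nonzero ideal such an R_i(u) is
   produced with the operators (ad R_i(1))^2 + 1, which annihilate R_(i+1)(O)
   and R_(i+2)(O) and are injective on R_i(O). *)

(** * Octonions *)

Section Octonions.
Variable F : fieldType.
Local Notation O := (octonion F).
Implicit Types (a b c u v w : O) (k x y : F).

Definition oct (x0 x1 x2 x3 x4 x5 x6 x7 : F) : O :=
  (((x0, x1), (x2, x3)), ((x4, x5), (x6, x7))).

Lemma octP (P : O -> Prop) :
  (forall x0 x1 x2 x3 x4 x5 x6 x7, P (oct x0 x1 x2 x3 x4 x5 x6 x7)) ->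
  forall a, P a.
Proof. by move=> Poct [[[? ?] [? ?]] [[? ?] [? ?]]]; apply: Poct. Qed.

Lemma cd_mulE (A : invalg F) (a b c d : A) :
  nmul ((a, b) : cayley_dickson A) (c, d)
    = (nmul a c - nmul (star d) b, nmul d a + nmul b (star c)).
Proof. by []. Qed.

(** The three doublings are expanded once here, so that later octonion identities split into
    polynomial identities in the coordinates, within reach of [ring]. *)
Lemma octM x0 x1 x2 x3 x4 x5 x6 x7 y0 y1 y2 y3 y4 y5 y6 y7 :
  nmul (oct x0 x1 x2 x3 x4 x5 x6 x7) (oct y0 y1 y2 y3 y4 y5 y6 y7) = oct
    (x0 * y0 - x1 * y1 - x2 * y2 - x3 * y3 - x4 * y4 - x5 * y5 - x6 * y6 - x7 * y7)
    (x0 * y1 + x1 * y0 + x2 * y3 - x3 * y2 + x4 * y5 - x5 * y4 - x6 * y7 + x7 * y6)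
    (x0 * y2 - x1 * y3 + x2 * y0 + x3 * y1 + x4 * y6 + x5 * y7 - x6 * y4 - x7 * y5)
    (x0 * y3 + x1 * y2 - x2 * y1 + x3 * y0 + x4 * y7 - x5 * y6 + x6 * y5 - x7 * y4)
    (x0 * y4 - x1 * y5 - x2 * y6 - x3 * y7 + x4 * y0 + x5 * y1 + x6 * y2 + x7 * y3)
    (x0 * y5 + x1 * y4 - x2 * y7 + x3 * y6 - x4 * y1 + x5 * y0 - x6 * y3 + x7 * y2)
    (x0 * y6 + x1 * y7 + x2 * y4 - x3 * y5 - x4 * y2 + x5 * y3 + x6 * y0 - x7 * y1)
    (x0 * y7 - x1 * y6 + x2 * y5 + x3 * y4 - x4 * y3 - x5 * y2 + x6 * y1 + x7 * y0).
Proof.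
rewrite /oct cd_mulE.
by congr ((_, _), (_, _), ((_, _), (_, _))); rewrite /= /cd_mul /=; ring.
Qed.

Lemma octS x0 x1 x2 x3 x4 x5 x6 x7 :
  star (oct x0 x1 x2 x3 x4 x5 x6 x7)
    = oct x0 (- x1) (- x2) (- x3) (- x4) (- x5) (- x6) (- x7).
Proof. by []. Qed.

Lemma oct0 : 0 = oct 0 0 0 0 0 0 0 0.
Proof. by []. Qed.

Lemma octD x0 x1 x2 x3 x4 x5 x6 x7 y0 y1 y2 y3 y4 y5 y6 y7 :
  oct x0 x1 x2 x3 x4 x5 x6 x7 + oct y0 y1 y2 y3 y4 y5 y6 y7
    = oct (x0 + y0) (x1 + y1) (x2 + y2) (x3 + y3) (x4 + y4) (x5 + y5) (x6 + y6)
        (x7 + y7).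
Proof. by []. Qed.

Lemma octZ k x0 x1 x2 x3 x4 x5 x6 x7 :
  k *: oct x0 x1 x2 x3 x4 x5 x6 x7
    = oct (k * x0) (k * x1) (k * x2) (k * x3) (k * x4) (k * x5) (k * x6)
        (k * x7).
Proof. by []. Qed.

Definition oct1 : O := oct 1 0 0 0 0 0 0 0.

(** The projections [.1.1.1] extract the real coordinate, so this is the symmetric bilinear form for
    which [odot a a] is the norm. *)
Definition odot a b : F := (nmul a (star b)).1.1.1.

Lemma odotE x0 x1 x2 x3 x4 x5 x6 x7 y0 y1 y2 y3 y4 y5 y6 y7 :
  odot (oct x0 x1 x2 x3 x4 x5 x6 x7) (oct y0 y1 y2 y3 y4 y5 y6 y7) =
    x0 * y0 + x1 * y1 + x2 * y2 + x3 * y3 + x4 * y4 + x5 * y5 + x6 * y6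
      + x7 * y7.
Proof. by rewrite /odot octS octM /oct /=; ring. Qed.

Definition octE := (octM, octS, octD, octZ, odotE).

Lemma oct_mul1l a : nmul oct1 a = a.
Proof. by elim/octP: a => *; rewrite !octE; congr oct; ring. Qed.

Lemma oct_mul1r a : nmul a oct1 = a.
Proof. by elim/octP: a => *; rewrite !octE; congr oct; ring. Qed.

Lemma star_oct1 : star oct1 = oct1.
Proof. by rewrite !octE oppr0. Qed.

Lemma odotC a b : odot a b = odot b a.
Proof. by elim/octP: a => *; elim/octP: b => *; rewrite !octE; ring. Qed.

Lemma odot_linear a : linear_for *%R (odot a).
Proof.
move=> k b c; elim/octP: a => *; elim/octP: b => *; elim/octP: c => *.
by rewrite !octE /=; ring.
Qed.

Lemma odot11 : odot oct1 oct1 = 1.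
Proof. by rewrite !octE; ring. Qed.

Lemma odot_star a b : odot (star a) (star b) = odot a b.
Proof. by elim/octP: a => *; elim/octP: b => *; rewrite !octE; ring. Qed.

Lemma oct_mul_starr a b :
  nmul a (star b) + nmul b (star a) = (2 * odot a b) *: oct1.
Proof.
elim/octP: a => *; elim/octP: b => *.
by rewrite !octE; congr oct; ring.
Qed.

(* The next two identities linearize star a (a c) = <a, a> c and its mirror
   image. *)
Lemma oct_alternative_l a b c :
  nmul (star a) (nmul b c) + nmul (star b) (nmul a c) = (2 * odot a b) *: c.
Proof.
elim/octP: a => *; elim/octP: b => *; elim/octP: c => *.
by rewrite !octE; congr oct; ring.
Qed.

Lemma oct_alternative_r a b c :
  nmul (nmul c a) (star b) + nmul (nmul c b) (star a) = (2 * odot a b) *: c.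
Proof.
elim/octP: a => *; elim/octP: b => *; elim/octP: c => *.
by rewrite !octE; congr oct; ring.
Qed.

(** The two sides are the real parts of [c (a b)] and [a (b c)]: real parts of triple products are
    invariant under cyclic permutation. *)
Lemma odot_cycle a b c :
  odot (star (nmul a b)) c = odot (star (nmul b c)) a.
Proof.
elim/octP: a => *; elim/octP: b => *; elim/octP: c => *.
by rewrite !octE; ring.
Qed.

Lemma opp_fixed x : 2 != 0 :> F -> - x = x -> x = 0.
Proof.
move=> nz2 eqx; apply: (mulfI nz2); rewrite mulr0 mulr_natl mulr2n -{1}eqx.
exact: addNr.
Qed.

(** Conjugation negates the seven imaginary coordinates, which therefore vanish. This is what makes
    the diagonal entries of a Hermitian matrix scalar. *)
Lemma oct_star_fixed a : 2 != 0 :> F -> star a = a -> a = odot a oct1 *: oct1.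
Proof.
move=> nz2; elim/octP: a => x0 x1 x2 x3 x4 x5 x6 x7; rewrite !octE.
case; do 7!move=> /(opp_fixed nz2)->.
by congr oct; ring.
Qed.

Definition oct_basis : seq O :=
  [:: oct1; oct 0 1 0 0 0 0 0 0; oct 0 0 1 0 0 0 0 0; oct 0 0 0 1 0 0 0 0;
      oct 0 0 0 0 1 0 0 0; oct 0 0 0 0 0 1 0 0; oct 0 0 0 0 0 0 1 0;
      oct 0 0 0 0 0 0 0 1].

Lemma oct_basis_expansion a : \sum_(u <- oct_basis) odot u a *: u = a.
Proof.
elim/octP: a => a0 a1 a2 a3 a4 a5 a6 a7; set a := oct a0 a1 a2 a3 a4 a5 a6 a7.
pose f u := odot u a *: u.
(* Adds one basis vector at a time with explicit coordinates, so that [ring] never meets a sum of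
   octonions. *)
have step x0 x1 x2 x3 x4 x5 x6 x7 y0 y1 y2 y3 y4 y5 y6 y7 s
    (k := odot (oct x0 x1 x2 x3 x4 x5 x6 x7) a) :
  \sum_(u <- s) f u = oct y0 y1 y2 y3 y4 y5 y6 y7 ->
  \sum_(u <- oct x0 x1 x2 x3 x4 x5 x6 x7 :: s) f u =
    oct (k * x0 + y0) (k * x1 + y1) (k * x2 + y2) (k * x3 + y3) (k * x4 + y4)
      (k * x5 + y5) (k * x6 + y6) (k * x7 + y7).
  by move=> IHs; rewrite big_cons IHs /f octZ octD.
apply: etrans; first by do 8!apply: (step); rewrite big_nil oct0.
by rewrite /a !odotE; congr oct; ring.
Qed.

Lemma oct_nucleus_r t :
    2 != 0 :> F -> odot t oct1 = 0 ->
    (forall a b, nmul (nmul a b) t = nmul a (nmul b t)) ->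
  t = 0.
Proof.
move=> nz2; elim/octP: t => x0 x1 x2 x3 x4 x5 x6 x7.
have simp := (@mul0r F, @mulr0 F, @mul1r F, @mulr1 F, @sub0r F, @subr0 F,
              @add0r F, @addr0 F, @oppr0 F, @opprK F).
rewrite odotE !simp => -> assoc.
(* In each line the two units generate a quaternion subalgebra, and associativity fails by a sign on
   the components of [t] outside it. The three subalgebras meet in the scalars, so the selected
   equations kill [x1] to [x7]. *)
have := assoc (oct 0 1 0 0 0 0 0 0) (oct 0 0 1 0 0 0 0 0).
have := assoc (oct 0 1 0 0 0 0 0 0) (oct 0 0 0 0 1 0 0 0).
have := assoc (oct 0 0 1 0 0 0 0 0) (oct 0 0 0 0 1 0 0 0).
rewrite !octM => -[_ + _ /esym + _ + _ /esym +] [_ _ _ + _ _ _ +]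
  [_ _ _ _ _ _ _ /esym +]; rewrite !simp.
by do 7!move=> /(opp_fixed nz2)->.
Qed.

End Octonions.

(** * Hermitian matrices *)

(* Locked, lest unification unfold the addition of matrices. *)
HB.lock Definition munit (F : fieldType) (n : nat) (A : invalg F)
    (p q : 'I_n) (a : A) : nmx n A :=
  [ffun ij => if ij == (p, q) then a else 0].

Section MatrixUnits.
Variables (F : fieldType) (n : nat) (A : invalg F).
Implicit Types (a b : A) (p q r t : 'I_n) (x y z : nmx n A).

Lemma munitE p q a ij : munit p q a ij = if ij == (p, q) then a else 0.
Proof. by rewrite unlock ffunE. Qed.

Lemma munitD p q a b : munit p q (a + b) = munit p q a + munit p q b.
Proof.
by apply/ffunP=> ij; rewrite !(munitE, ffunE); case: ifP; rewrite ?addr0.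
Qed.

Lemma munitZ p q k a : munit p q (k *: a) = k *: munit p q a.
Proof.
by apply/ffunP=> ij; rewrite !(munitE, ffunE); case: ifP; rewrite ?scaler0.
Qed.

Lemma munit_mul p q r t a b :
  nmx_mul (munit p q a) (munit r t b)
    = if q == r then munit p t (nmul a b) else 0.
Proof.
apply/ffunP=> -[i j]; rewrite ffunE /= (bigD1 q) //= big1 => [|k /negPf neq_kq].
  rewrite !(munitE, ffunE) !xpair_eqE eqxx andbT addr0.
  case: (q =P r) => _; rewrite ?(munitE, ffunE) ?xpair_eqE /= ?nmul0r //.
  by case: (i == p); case: (j == t); rewrite ?nmul0l ?nmul0r.
by rewrite !(munitE, ffunE) !xpair_eqE neq_kq andbF nmul0l.
Qed.

Lemma conjtr_munit p q a : conjtr (munit p q a) = munit q p (star a).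
Proof.
apply/ffunP=> -[i j]; rewrite !(munitE, ffunE) !xpair_eqE andbC.
by case: ifP; rewrite ?star0.
Qed.

Lemma conjtrD x y : conjtr (x + y) = conjtr x + conjtr y.
Proof. by apply/ffunP=> ij; rewrite !ffunE starD. Qed.

Lemma nmx_mulDl x y z : nmx_mul (x + y) z = nmx_mul x z + nmx_mul y z.
Proof.
apply/ffunP=> ij; rewrite !ffunE -big_split; apply: eq_bigr => k _.
by rewrite ffunE nmulDl.
Qed.

Lemma nmx_mulDr x y z : nmx_mul x (y + z) = nmx_mul x y + nmx_mul x z.
Proof.
apply/ffunP=> ij; rewrite !ffunE -big_split; apply: eq_bigr => k _.
by rewrite ffunE nmulDr.
Qed.

End MatrixUnits.

(** * Cyclic indices modulo 3 *)

Section CyclicOrd3.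
Implicit Types i j : 'I_3.

Lemma ordS3K i : ordS (ordS (ordS i)) = i.
Proof. by apply: val_inj; case: i => [[|[|[|]]]]. Qed.

Lemma ordS3_neq i :
  (i == ordS i = false) * (i == ordS (ordS i) = false)
  * (ordS i == i = false) * (ordS (ordS i) == i = false).
Proof. by case: i => [[|[|[|]]]]. Qed.

(** The rewriting rules name slots relative to a base [i]; a case split on [j] must therefore
    produce successors of [i]. *)
Variant ordS3_spec i : 'I_3 -> Type :=
  | OrdS3_0 : ordS3_spec i i
  | OrdS3_1 : ordS3_spec i (ordS i)
  | OrdS3_2 : ordS3_spec i (ordS (ordS i)).

Lemma ordS3P i j : ordS3_spec i j.
Proof.
have [->|ne0] := eqVneq j i; first exact: OrdS3_0.
have [->|ne1] := eqVneq j (ordS i); first exact: OrdS3_1.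
have [->|ne2] := eqVneq j (ordS (ordS i)); first exact: OrdS3_2.
by case: i j ne0 ne1 ne2 => [[|[|[|//]]] ?] [[|[|[|//]]] ?].
Qed.

End CyclicOrd3.

(* The properties of octonions on which the proof relies, abstracted so that
   unification never computes with eight coordinates. The norm of a is
   cdot a a. *)
Record compAlg (F : fieldType) := CompAlg {
  comp_alg :> invalg F;
  cone : comp_alg;
  cdot : comp_alg -> comp_alg -> F;
  cbasis : seq comp_alg;
  cmul1l : forall a, nmul cone a = a;
  cmul1r : forall a, nmul a cone = a;
  star_cone : star cone = cone;
  cdotC : forall a b, cdot a b = cdot b a;
  cdot_linear : forall a, linear_for *%R (cdot a);
  cdot11 : cdot cone cone = 1;
  cdot_star : forall a b, cdot (star a) (star b) = cdot a b;
  cdot_cycle : forall a b c,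
    cdot (star (nmul a b)) c = cdot (star (nmul b c)) a;
  cmul_star : forall a b,
    nmul a (star b) + nmul b (star a) = (2 * cdot a b) *: cone;
  cmul_alternative_l : forall a b c,
    nmul (star a) (nmul b c) + nmul (star b) (nmul a c) = (2 * cdot a b) *: c;
  cmul_alternative_r : forall a b c,
    nmul (nmul c a) (star b) + nmul (nmul c b) (star a) = (2 * cdot a b) *: c;
  star_fixed : forall a, star a = a -> a = cdot a cone *: cone;
  cbasis_expansion : forall a, \sum_(u <- cbasis) cdot u a *: u = a;
  cnucleus : forall t, cdot t cone = 0 ->
    (forall a b, nmul (nmul a b) t = nmul a (nmul b t)) -> t = 0
}.

Arguments cone {F c0}.
Arguments cdot {F c0} a b.

Section CompAlgTheory.
Variables (F : fieldType) (O : compAlg F).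
Implicit Types a b : O.

HB.instance Definition _ a :=
  GRing.isLinear.Build F O F _ (cdot a) (cdot_linear a).

Lemma cdot_nondegenerate a : a != 0 -> exists b, cdot b a != 0.
Proof.
move=> nz_a.
have [/hasP[u _ nz_u]|no_u] := boolP (has (fun u => cdot u a != 0) (cbasis O)).
  by exists u.
case/eqP: nz_a; rewrite -[LHS]cbasis_expansion big_seq big1 // => u u_in.
by have /hasPn/(_ u u_in)/negPn/eqP-> := no_u; rewrite scale0r.
Qed.

End CompAlgTheory.

(* Twice the product: on Hermitian matrices it has integral structure
   constants. *)
HB.lock Definition jdot (F : fieldType) (J : nalg F) (x y : J) : J :=
  2 *: nmul x y.

Section JDot.
Variables (F : fieldType) (J : nalg F).
Implicit Types x y z : J.

Lemma jdotE x y : jdot x y = 2 *: nmul x y.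
Proof. by rewrite unlock. Qed.

Fact jdot_linear x : linear (jdot x).
Proof.
by move=> k y z; rewrite !jdotE nmul_linearr scalerDr !scalerA mulrC.
Qed.
HB.instance Definition _ x :=
  GRing.isLinear.Build F J J _ (jdot x) (jdot_linear x).

Lemma jdotDl x y z : jdot (x + y) z = jdot x z + jdot y z.
Proof. by rewrite !jdotE nmulDl scalerDr. Qed.

Lemma jdotNl x y : jdot (- x) y = - jdot x y.
Proof. by rewrite !jdotE nmulNl scalerN. Qed.

Lemma jdotZl k x y : jdot (k *: x) y = k *: jdot x y.
Proof. by rewrite !jdotE nmulZl !scalerA mulrC. Qed.

Lemma jdot0l x : jdot 0 x = 0.
Proof. by rewrite jdotE nmul0l scaler0. Qed.

Lemma derivationP (D : 'End(J)) : 2 != 0 :> F ->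
  is_derivation D
    <-> forall x y, D (jdot x y) = jdot (D x) y + jdot x (D y).
Proof.
move=> nz2; split=> derD x y; first by rewrite !jdotE linearZ /= derD scalerDr.
by apply: (scalerI nz2); have := derD x y; rewrite !jdotE linearZ /= scalerDr.
Qed.

End JDot.

(* In the Hermitian matrices, offdiag i a has a in position (i+1, i+2) and
   star a in position (i+2, i+1), indices mod 3. *)
Record peirceFrame (F : fieldType) (O : compAlg F) (J : nalg F) :=
  PeirceFrame {
  idem : 'I_3 -> J;
  offdiag : 'I_3 -> O -> J;
  diagcoord : J -> 'I_3 -> F;
  offcoord : J -> 'I_3 -> O;
  offdiag_linear : forall i, linear (offdiag i);
  offdiagK : forall i a, offcoord (offdiag i a) i = a;
  peirce_decomposition : forall i x,
    x = diagcoord x i *: idem i + diagcoord x (ordS i) *: idem (ordS i)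
          + diagcoord x (ordS (ordS i)) *: idem (ordS (ordS i))
        + (offdiag i (offcoord x i)
           + offdiag (ordS i) (offcoord x (ordS i))
           + offdiag (ordS (ordS i)) (offcoord x (ordS (ordS i))));
  jdotC : forall x y : J, jdot x y = jdot y x;
  idem_idem : forall i, jdot (idem i) (idem i) = idem i + idem i;
  idem_idemS : forall i, jdot (idem i) (idem (ordS i)) = 0;
  idem_offdiag : forall i a, jdot (idem i) (offdiag i a) = 0;
  idemS_offdiag : forall i a, jdot (idem (ordS i)) (offdiag i a) = offdiag i a;
  idemSS_offdiag : forall i a,
    jdot (idem (ordS (ordS i))) (offdiag i a) = offdiag i a;
  offdiag_offdiag : forall i a b,
    jdot (offdiag i a) (offdiag i b)
      = (2 * cdot a b) *: (idem (ordS i) + idem (ordS (ordS i)));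
  offdiag_offdiagS : forall i a b,
    jdot (offdiag i a) (offdiag (ordS i) b)
      = offdiag (ordS (ordS i)) (star (nmul a b))
}.

(** * The Peirce frame of the Hermitian matrices *)

Section HermitianFrame.
Variables (F : fieldType) (O : compAlg F).
Hypothesis nz2 : 2 != 0 :> F.
Local Notation J := (hermitian_jordan 3 O).
Local Notation S := (@ordS 3).
Implicit Types (i j : 'I_3) (a b c : O) (x y z : J).

Let ordS3E := (ordS3_neq, ordS3K, eqxx).

Fact idem_subproof i : munit i i cone \in Defs.hermitian 3 O.
Proof. by rewrite mem_hermitian conjtr_munit star_cone. Qed.

Definition herm_idem i : J := Subvs (idem_subproof i).

Fact offdiag_subproof i a :
  munit (S i) (S (S i)) a + munit (S (S i)) (S i) (star a)
    \in Defs.hermitian 3 O.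
Proof. by rewrite mem_hermitian conjtrD !conjtr_munit starK addrC. Qed.

Definition herm_offdiag i a : J := Subvs (offdiag_subproof i a).

Lemma vsval_inj x y : vsval x = vsval y -> x = y.
Proof. exact: val_inj. Qed.

Lemma vsvalD x y : vsval (x + y) = vsval x + vsval y.
Proof. exact: linearD. Qed.

Lemma vsvalZ k x : vsval (k *: x) = k *: vsval x.
Proof. exact: linearZ. Qed.

Lemma vsval0 : vsval (0 : J) = 0.
Proof. exact: linear0. Qed.

Lemma val_herm_offdiag i a :
  vsval (herm_offdiag i a)
    = munit (S i) (S (S i)) a + munit (S (S i)) (S i) (star a).
Proof. by []. Qed.

Lemma val_herm_idem i : vsval (herm_idem i) = munit i i cone.
Proof. by []. Qed.

Fact herm_offdiag_linear i : linear (herm_offdiag i).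
Proof.
move=> k a b; apply: vsval_inj; rewrite vsvalD vsvalZ !val_herm_offdiag.
by rewrite starD starZ !munitD !munitZ scalerDr; exact: addrACA.
Qed.

Lemma double_half (V : lmodType F) (v : V) : 2 *: (2^-1 *: v) = v.
Proof. by rewrite scalerA mulfV ?scale1r. Qed.

Lemma val_jdot x y :
  vsval (jdot x y) = nmx_mul (vsval x) (vsval y) + nmx_mul (vsval y) (vsval x).
Proof. by rewrite jdotE vsvalZ; exact: double_half. Qed.

Let mulE := (val_jdot, vsvalD, vsvalZ, vsval0, val_herm_idem, val_herm_offdiag,
             nmx_mulDl, nmx_mulDr, munit_mul, ordS3E, addr0, add0r,
             cmul1l, cmul1r, star_cone).

Lemma herm_idem_idem i :
  jdot (herm_idem i) (herm_idem i) = herm_idem i + herm_idem i.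
Proof. by apply: vsval_inj; rewrite !mulE. Qed.

Lemma herm_idem_idemS i : jdot (herm_idem i) (herm_idem (S i)) = 0.
Proof. by apply: vsval_inj; rewrite !mulE. Qed.

Lemma herm_idem_offdiag i a : jdot (herm_idem i) (herm_offdiag i a) = 0.
Proof. by apply: vsval_inj; rewrite !mulE. Qed.

Lemma herm_idemS_offdiag i a :
  jdot (herm_idem (S i)) (herm_offdiag i a) = herm_offdiag i a.
Proof. by apply: vsval_inj; rewrite !mulE. Qed.

Lemma herm_idemSS_offdiag i a :
  jdot (herm_idem (S (S i))) (herm_offdiag i a) = herm_offdiag i a.
Proof. by apply: vsval_inj; rewrite !mulE addrC. Qed.

Lemma herm_offdiag_offdiag i a b :
  jdot (herm_offdiag i a) (herm_offdiag i b)
    = (2 * cdot a b) *: (herm_idem (S i) + herm_idem (S (S i))).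
Proof.
apply: vsval_inj; rewrite !mulE scalerDr; apply: etrans (addrACA _ _ _ _) _.
congr (_ + _); rewrite -munitD -munitZ; congr munit.
  exact: cmul_star.
(* The other diagonal entry is the same expression in the conjugates of [a] and [b]. *)
by have := cmul_star (star a) (star b); rewrite !starK cdot_star => <-.
Qed.

(** Positions (i+1, i+2) and (i+2, i) multiply into (i+1, i), which is the transposed position of
    slot i+2; hence the conjugate. *)
Lemma herm_offdiag_offdiagS i a b :
  jdot (herm_offdiag i a) (herm_offdiag (S i) b)
    = herm_offdiag (S (S i)) (star (nmul a b)).
Proof.
by apply: vsval_inj; rewrite !mulE starM -starM starK addrC.
Qed.

Definition herm_offcoord x i : O := vsval x (S i, S (S i)).

Definition herm_diagcoord x i : F := cdot (vsval x (i, i)) cone.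

Lemma herm_offcoord_offdiag i a : herm_offcoord (herm_offdiag i a) i = a.
Proof.
rewrite /herm_offcoord val_herm_offdiag ffunE !munitE !xpair_eqE !ordS3E.
exact: addr0.
Qed.

Lemma herm_peirce_decomposition i x :
  x = herm_diagcoord x i *: herm_idem i
        + herm_diagcoord x (S i) *: herm_idem (S i)
        + herm_diagcoord x (S (S i)) *: herm_idem (S (S i))
      + (herm_offdiag i (herm_offcoord x i)
           + herm_offdiag (S i) (herm_offcoord x (S i))
           + herm_offdiag (S (S i)) (herm_offcoord x (S (S i)))).
Proof.
have herm_x p q : star (vsval x (q, p)) = vsval x (p, q).
  have := subvsP x; rewrite mem_hermitian => /eqP conj_x.
  by rewrite -[in RHS]conj_x ffunE.
have diag_x p : herm_diagcoord x p *: cone = vsval x (p, p).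
  by rewrite -star_fixed.
apply: vsval_inj; rewrite !(vsvalD, vsvalZ, val_herm_idem, val_herm_offdiag).
rewrite -!munitZ !diag_x /herm_offcoord !herm_x !ordS3K; apply/ffunP=> -[p q].
rewrite !(munitE, ffunE) !xpair_eqE.
by case: (ordS3P i p); case: (ordS3P i q);
  rewrite !(ordS3E, inj_eq (@ordS_inj 3)) ?(addr0, add0r).
Qed.

Lemma herm_jdotC x y : jdot x y = jdot y x.
Proof. by apply: vsval_inj; rewrite !val_jdot addrC. Qed.

Definition hermitian_frame : peirceFrame O J :=
  PeirceFrame herm_offdiag_linear herm_offcoord_offdiag
    herm_peirce_decomposition herm_jdotC herm_idem_idem herm_idem_idemS
    herm_idem_offdiag herm_idemS_offdiag herm_idemSS_offdiag
    herm_offdiag_offdiag herm_offdiag_offdiagS.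

End HermitianFrame.

(** * The derivations R_i(a) *)

Section JMul.
Variables (F : fieldType) (J : nalg F).
Implicit Types (x y : J) (D : 'End(J)).

Lemma lfun_linE k D D' x : (k *: D + D') x = k *: D x + D' x.
Proof. by rewrite lfunE /= lfunE. Qed.

Definition jmul x : 'End(J) := linfun (jdot x).

Lemma jmulE x y : jmul x y = jdot x y.
Proof. by rewrite lfunE. Qed.

End JMul.

(* On Hermitian matrices, the commutator with the skew-Hermitian matrix having a
   in position (i+1, i+2) and - star a in position (i+2, i+1). *)
HB.lock Definition rotation (F : fieldType) (O : compAlg F) (J : nalg F)
    (fr : peirceFrame O J) (i : 'I_3) (a : O) : 'End(J) :=
  commutator (jmul (idem fr (ordS i))) (jmul (offdiag fr i a)).

Section Rotations.
Variables (F : fieldType) (O : compAlg F) (J : nalg F) (fr : peirceFrame O J).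
Hypothesis nz2 : 2 != 0 :> F.
Local Notation S := (@ordS 3).
Local Notation e := (idem fr).
Local Notation X := (offdiag fr).
Implicit Types (i j : 'I_3) (a b c : O) (x y z : J) (D : 'End(J)).

HB.instance Definition _ i :=
  GRing.isLinear.Build F O J _ (X i) (offdiag_linear fr i).

Lemma idem_idemSS i : jdot (e i) (e (S (S i))) = 0.
Proof. by rewrite (jdotC fr) -[in X in jdot _ X](ordS3K i) idem_idemS. Qed.

Lemma idemS_idem i : jdot (e (S i)) (e i) = 0.
Proof. by rewrite (jdotC fr) idem_idemS. Qed.

Lemma idemSS_idem i : jdot (e (S (S i))) (e i) = 0.
Proof. by rewrite (jdotC fr) idem_idemSS. Qed.

Lemma idem_offdiagS i a : jdot (e i) (X (S i) a) = X (S i) a.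
Proof. by rewrite -{1}(ordS3K i) idemSS_offdiag. Qed.

Lemma idem_offdiagSS i a : jdot (e i) (X (S (S i)) a) = X (S (S i)) a.
Proof. by rewrite -{1}(ordS3K i) idemS_offdiag. Qed.

Lemma offdiag_idem i j a : jdot (X i a) (e j) = jdot (e j) (X i a).
Proof. exact: (jdotC fr). Qed.

Lemma offdiagS_offdiag i a b :
  jdot (X (S i) a) (X i b) = X (S (S i)) (star (nmul b a)).
Proof. by rewrite (jdotC fr) offdiag_offdiagS. Qed.

Lemma offdiagSS_offdiag i a b :
  jdot (X (S (S i)) a) (X i b) = X (S i) (star (nmul a b)).
Proof. by rewrite -{2}(ordS3K i) offdiag_offdiagS !ordS3K. Qed.

Lemma offdiag_offdiagSS i a b :
  jdot (X i a) (X (S (S i)) b) = X (S i) (star (nmul b a)).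
Proof. by rewrite (jdotC fr) offdiagSS_offdiag. Qed.

Definition frameE := (idem_idem, idem_idemS, idem_idemSS, idemS_idem,
  idemSS_idem, idem_offdiag, idemS_offdiag, idemSS_offdiag, idem_offdiagS,
  idem_offdiagSS,
  offdiag_idem, offdiag_offdiag, offdiag_offdiagS, offdiagS_offdiag,
  offdiagSS_offdiag, offdiag_offdiagSS).

Lemma frame_ind (P : J -> Prop) i :
    (forall x y, P x -> P y -> P (x + y)) -> (forall k x, P x -> P (k *: x)) ->
    P (e i) -> P (e (S i)) -> P (e (S (S i))) ->
    (forall a, P (X i a)) -> (forall a, P (X (S i) a)) ->
    (forall a, P (X (S (S i)) a)) ->
  forall x, P x.
Proof.
move=> PD PZ ? ? ? ? ? ? x; rewrite (peirce_decomposition fr i x).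
by do ![apply: (PD) => // | apply: (PZ) => //].
Qed.

(** Both idempotents act as the identity on slot [i], and one of the two products kills every other
    component. A coordinate is thus expressed by Jordan products, through which derivations can be
    pushed. *)
Lemma offdiag_projection i x :
  jdot (e (S i)) (jdot (e (S (S i))) x) = X i (offcoord fr x i).
Proof.
rewrite {1}(peirce_decomposition fr i x).
rewrite !(linearD, linearZ) /= !frameE !(linearD, linearZ, linear0) /= !frameE.
by rewrite !(linear0, scaler0, addr0, add0r).
Qed.

Local Notation rotation := (rotation fr).

Lemma rotationE i a x :
  rotation i a x
    = jdot (e (S i)) (jdot (X i a) x) - jdot (X i a) (jdot (e (S i)) x).
Proof. by rewrite rotation.unlock commutatorE !jmulE. Qed.

Fact rotation_linear i : linear (rotation i).
Proof.
move=> k a b; apply/lfunP=> x; rewrite lfun_linE !rotationE.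
rewrite (linearP (X i)) /= !jdotDl !jdotZl linearP /= scalerBr.
by rewrite opprD addrACA.
Qed.
HB.instance Definition _ i :=
  GRing.isLinear.Build F O 'End(J) _ (rotation i) (rotation_linear i).

Lemma rotation_idem i a : rotation i a (e i) = 0.
Proof. by rewrite rotationE !frameE !linear0 addr0. Qed.

Lemma rotation_idemS i a : rotation i a (e (S i)) = - X i a.
Proof.
by rewrite rotationE !frameE linearD /= !frameE opprD addrA subrr sub0r.
Qed.

Lemma rotation_idemSS i a : rotation i a (e (S (S i))) = X i a.
Proof. by rewrite rotationE !frameE linear0 subr0. Qed.

Lemma rotation_offdiag i a b :
  rotation i a (X i b) = (2 * cdot a b) *: (e (S i) - e (S (S i))).
Proof.
rewrite rotationE !frameE linearZ /= linearD /= !frameE addr0 -scalerBr.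
by rewrite opprD addrA addrK.
Qed.

Lemma rotation_offdiagS i a b :
  rotation i a (X (S i) b) = X (S (S i)) (star (nmul a b)).
Proof. by rewrite rotationE !frameE linear0 subr0. Qed.

Lemma rotation_offdiagSS i a b :
  rotation i a (X (S (S i)) b) = - X (S i) (star (nmul b a)).
Proof. by rewrite rotationE !frameE sub0r. Qed.

Lemma rotationS_idem i a : rotation (S i) a (e i) = X (S i) a.
Proof. by rewrite -[in e i](ordS3K i) rotation_idemSS. Qed.

Lemma rotationSS_idem i a : rotation (S (S i)) a (e i) = - X (S (S i)) a.
Proof. by rewrite -[in e i](ordS3K i) rotation_idemS. Qed.

Definition rotationsE := (rotationS_idem, rotationSS_idem, rotation_idem,
  rotation_idemS, rotation_idemSS, rotation_offdiag, rotation_offdiagS,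
  rotation_offdiagSS).

(** The Leibniz rule is bilinear and symmetric in its arguments, so it is checked on pairs of frame
    elements. For off-diagonal pairs not both in slot [i] it amounts to the linearized alternative
    laws and, for slots i+1 and i+2, to [cdot_cycle]. *)
Lemma rotation_derivation i a : is_derivation (rotation i a).
Proof.
apply/derivationP => //; set D := rotation i a.
pose leib x y := D (jdot x y) = jdot (D x) y + jdot x (D y).
have leibC x y : leib x y -> leib y x.
  by rewrite /leib (jdotC fr y) (jdotC fr y) (jdotC fr _ x) addrC.
have leibD x y z : leib x y -> leib x z -> leib x (y + z).
  by rewrite /leib !linearD /= => -> ->; rewrite addrACA.
have leibZ x k y : leib x y -> leib x (k *: y).
  by rewrite /leib !linearZ /= => ->; rewrite scalerDr.
have step := (ordS3K, frameE, rotationsE, jdot0l, jdotNl, jdotZl, jdotDl).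
have simp := (oppr0, addr0, add0r, scaler0, addNr, addrN, starM, starK).
have leib_ee0 j : leib (e i) (e j).
  rewrite /leib /D; case: (ordS3P i j);
    by rewrite !step ?(linearD, linearN, linear0) /= ?step ?simp.
have leib_ee1 : leib (e (S i)) (e (S i)).
  by rewrite /leib /D !step linearD linearN /= !step.
have leib_ee2 : leib (e (S (S i))) (e (S (S i))).
  by rewrite /leib /D !step linearD /= !step.
have leib_ee12 : leib (e (S i)) (e (S (S i))).
  by rewrite /leib /D !step linear0 addNr.
have leib_e0X j b : leib (e i) (X j b).
  rewrite /leib /D; case: (ordS3P i j);
    rewrite !step ?(linearZ, linearN, linear0) /= ?linearB /= ?step ?simp //.
have leib_e1X j b : leib (e (S i)) (X j b).
  rewrite /leib /D; case: (ordS3P i j);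
    rewrite !step ?(linearZ, linearN, linear0) /= ?linearB /= ?step ?simp //.
  rewrite -scalerBr -scalerDr [X in _ = _ *: X]addrC opprD addrACA subrr.
  by rewrite add0r.
have leib_e2X j b : leib (e (S (S i))) (X j b).
  rewrite /leib /D; case: (ordS3P i j);
    rewrite !step ?(linearZ, linearN, linear0) /= ?linearB /= ?step ?simp //.
  by rewrite -!scalerBr opprD addrACA subrr addr0.
have leib_X00 b c : leib (X i b) (X i c).
  rewrite /leib /D !step linearZ linearD /= !step !linearZ /= !linearB /=.
  by rewrite !step !simp.
have leib_X01 b c : leib (X i b) (X (S i) c).
  rewrite /leib /D !step linearB /= ?step !simp -linearZ.
  by rewrite -cmul_alternative_l linearD /= opprD subrK.
have leib_X02 b c : leib (X i b) (X (S (S i)) c).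
  rewrite /leib /D !step linearB linearN /= !step !simp -linearZ.
  by rewrite -cmul_alternative_r linearD /= addrAC subrr add0r.
have leib_X11 b c : leib (X (S i) b) (X (S i) c).
  rewrite /leib /D !step linearZ linearD /= !step !simp.
  by rewrite -linearZ -cmul_alternative_r linearD.
have leib_X12 b c : leib (X (S i) b) (X (S (S i)) c).
  rewrite /leib /D !step linearN /= !step.
  rewrite (cdotC a) -(cdot_cycle a) (cdotC b) (cdot_cycle c a b).
  by rewrite -scalerBr (addrC (e i)) opprD addrACA subrr addr0.
have leib_X22 b c : leib (X (S (S i)) b) (X (S (S i)) c).
  rewrite /leib /D !step linearZ linearD linearN /= !step !simp.
  by rewrite scalerN -linearZ -cmul_alternative_l linearD opprD addrC.
have leibx x : (forall j, leib x (e j)) -> (forall j b, leib x (X j b)) ->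
    forall y, leib x y.
  move=> xe xX; apply: (@frame_ind _ i) => // [y z|k y].
    exact: leibD.
  exact: leibZ.
apply: (@frame_ind (fun x => forall y, leib x y) i).
- move=> x y leib_x leib_y z.
  by apply: (leibC); apply: (leibD); apply: (leibC).
- by move=> k x leib_x y; apply: (leibC); apply: (leibZ); apply: (leibC).
- exact: leibx.
- by apply: leibx => // j; case: (ordS3P i j) => //; apply: leibC.
- by apply: leibx => // j; case: (ordS3P i j) => //; apply: leibC.
- move=> b; apply: leibx => [j | j c].
    by apply: (leibC); case: (ordS3P i j).
  by case: (ordS3P i j).
- move=> b; apply: leibx => [j | j c].
    by apply: (leibC); case: (ordS3P i j).
  by case: (ordS3P i j) => //; apply: leibC.
- move=> b; apply: leibx => [j | j c].
    by apply: (leibC); case: (ordS3P i j).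
  by case: (ordS3P i j) => //; apply: leibC.
Qed.

End Rotations.

(** * Structure of the derivation algebra *)

Section Commutators.
Variables (F : fieldType) (J : nalg F).
Implicit Types (D A B : 'End(J)) (x y : J).

HB.instance Definition _ D :=
  GRing.isLinear.Build F 'End(J) 'End(J) _ (commutator D)
    (commutator_linearr D).

Lemma commutatorDr D A B :
  commutator D (A + B) = commutator D A + commutator D B.
Proof. exact: (linearD (commutator D)). Qed.

Lemma commutatorNr D A : commutator D (- A) = - commutator D A.
Proof. exact: (linearN (commutator D)). Qed.

Lemma commutator0r D : commutator D 0 = 0.
Proof. exact: (linear0 (commutator D)). Qed.

Lemma commutatorDl D A B :
  commutator (D + A) B = commutator D B + commutator A B.
Proof. by rewrite commutatorC commutatorDr opprD -!(commutatorC _ B). Qed.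

Lemma commutator0l D : commutator 0 D = 0.
Proof. by rewrite commutatorC commutator0r oppr0. Qed.

Lemma commutator_leibniz D A B :
  commutator D (commutator A B)
    = commutator (commutator D A) B + commutator A (commutator D B).
Proof.
have := commutator_jacobi D A B; rewrite (commutatorC B D) commutatorNr.
rewrite (commutatorC B (commutator D A)) => /eqP.
by rewrite subr_eq0 subr_eq => /eqP->.
Qed.

Fact jmul_linear : linear (@jmul F J).
Proof.
move=> k x y; apply/lfunP=> z.
by rewrite lfun_linE !jmulE jdotDl jdotZl.
Qed.
HB.instance Definition _ :=
  GRing.isLinear.Build F J 'End(J) _ (@jmul F J) jmul_linear.

Lemma commutator_jmul D x :
  2 != 0 :> F -> D \in der J -> commutator D (jmul x) = jmul (D x).
Proof.
move=> nz2 /derP/(derivationP _ nz2) derD; apply/lfunP=> y.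
by rewrite commutatorE !jmulE derD addrK.
Qed.

End Commutators.

(** * Brackets of rotations, the stabilizer of the frame, and the decomposition of a derivation *)

Section FrameDerivations.
Variables (F : fieldType) (O : compAlg F) (J : nalg F) (fr : peirceFrame O J).
Hypothesis nz2 : 2 != 0 :> F.
Local Notation S := (@ordS 3).
Local Notation e := (idem fr).
Local Notation X := (offdiag fr).
Implicit Types (i j : 'I_3) (a b c u v w : O) (x y z : J) (D : 'End(J)).

Lemma offdiag_inj i : injective (X i).
Proof. by move=> a b eqX; rewrite -(offdiagK fr i a) eqX offdiagK. Qed.

Lemma rotation_der i a : rotation fr i a \in der J.
Proof. exact/derP/rotation_derivation. Qed.

(** A rotation can be written with either of two idempotents. In a bracket of rotations from
    distinct slots, choosing the idempotent killed by the first rotation leaves a single Leibniz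
    term. *)
Lemma rotation_sym i a :
  rotation fr i a = - commutator (jmul (e (S (S i)))) (jmul (X i a)).
Proof.
apply/lfunP; apply: (@frame_ind _ _ _ fr _ i) => [x y|k x||||b|b|b].
- by rewrite !linearD /= => -> ->.
- by rewrite !linearZ /= => ->.
all: rewrite opp_lfunE commutatorE !jmulE !frameE !rotationsE ?linear0.
- by rewrite addr0 oppr0.
- by rewrite addr0.
- by rewrite (linearD (jdot _)) /= !frameE opprB addrK.
- rewrite linearZ (linearD (jdot _)) /= !frameE add0r opprB -scalerBr.
  by rewrite opprD addrA addrK.
- by rewrite sub0r opprK.
- by rewrite addr0.
Qed.

Lemma commutator_rotation D i a : D \in der J ->
  commutator D (rotation fr i a)
    = commutator (jmul (D (e (S i)))) (jmul (X i a))
      + commutator (jmul (e (S i))) (jmul (D (X i a))).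
Proof.
move=> derD; rewrite rotation.unlock commutator_leibniz.
by rewrite !(commutator_jmul _ nz2 derD).
Qed.

Lemma commutator_rotation_rotationS i a b :
  commutator (rotation fr i a) (rotation fr (S i) b)
    = - rotation fr (S (S i)) (star (nmul a b)).
Proof.
rewrite (rotation_sym (S i)) commutatorNr commutator_leibniz.
rewrite !(commutator_jmul _ nz2 (rotation_der _ _)).
rewrite ordS3K rotation_idem rotation_offdiagS linear0 commutator0l add0r.
by rewrite rotation.unlock ordS3K.
Qed.

Lemma commutator_rotation_rotationSS i a b :
  commutator (rotation fr i a) (rotation fr (S (S i)) b)
    = rotation fr (S i) (star (nmul b a)).
Proof.
rewrite commutator_rotation ?rotation_der // ordS3K rotation_idem linear0.
rewrite commutator0l add0r rotation_offdiagSS linearN commutatorNr.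
by rewrite rotation_sym ordS3K.
Qed.

(** The subalgebra D_0: killing the idempotents is the infinitesimal form of fixing them. *)
Definition fixes_frame D := D \in der J /\ forall i, D (e i) = 0.

Definition offact D i a : O := offcoord fr (D (X i a)) i.

Lemma derE D x y : D \in der J -> D (jdot x y) = jdot (D x) y + jdot x (D y).
Proof. by move=> /derP/(derivationP _ nz2). Qed.

(** The projection onto slot [i] is made of products by idempotents, and these commute with [D]. *)
Lemma offactE D i a : fixes_frame D -> D (X i a) = X i (offact D i a).
Proof.
case=> derD De; rewrite -(offdiag_projection fr i) -[in LHS](idemS_offdiag fr).
by rewrite -[in LHS](idemSS_offdiag fr) !derE // !De !jdot0l !add0r.
Qed.

Lemma commutator_fix_rotation D i a : fixes_frame D ->
  commutator D (rotation fr i a) = rotation fr i (offact D i a).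
Proof.
case=> derD De; rewrite commutator_rotation // De linear0 commutator0l add0r.
by rewrite offactE // rotation.unlock.
Qed.

Lemma fixes_frameD D D' :
  fixes_frame D -> fixes_frame D' -> fixes_frame (D + D').
Proof.
move=> [derD De] [derD' D'e]; split=> [|i]; first exact: rpredD.
by rewrite add_lfunE De D'e addr0.
Qed.

Lemma commutator_rotations_fix i a b :
  fixes_frame (commutator (rotation fr i a) (rotation fr i b)).
Proof.
split=> [|j]; first by apply: commutator_der; apply: rotation_der.
rewrite commutatorE; case: (ordS3P i j); rewrite !rotationsE ?linearN ?linear0.
- by rewrite addr0.
- by rewrite /= !rotationsE (cdotC a) subrr.
- by rewrite (cdotC a) subrr.
Qed.

(** The result is four times the elementary skew map of the pair [a], [b]; such maps span the
    orthogonal Lie algebra of [cdot]. *)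
Lemma offact_rotations i a b c :
  offact (commutator (rotation fr i a) (rotation fr i b)) i c
    = (4 * cdot a c) *: b - (4 * cdot b c) *: a.
Proof.
apply: (@offdiag_inj i); rewrite -offactE; last exact: commutator_rotations_fix.
rewrite commutatorE !rotationsE !linearZ /= !linearB /= !rotationsE !linearZ /=.
rewrite opprK linearD !linearZ /= (linearN (X i)) addrC -!scalerDl.
by congr (_ *: _ + _ *: _); ring.
Qed.

Lemma cone_neq0 : cone != 0 :> O.
Proof.
apply: contra_neq (oner_neq0 F) => cone0.
by rewrite -(cdot11 O) [X in cdot _ X]cone0 linear0.
Qed.

Lemma idem_sum_eq0 k i : k *: (e (S i) + e (S (S i))) = 0 -> k = 0.
Proof.
move=> /(congr1 (jdot (X i cone))); rewrite linear0 linearZ linearD /= !frameE.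
rewrite -mulr2n -scaler_nat scalerA -linearZ /= -(linear0 (X i)).
move=> /offdiag_inj/eqP; rewrite scaler_eq0 (negPf cone_neq0) orbF mulf_eq0.
by rewrite (negPf nz2) orbF => /eqP.
Qed.

(** Differentiate [offdiag_offdiag]: [D] kills the idempotents on its right-hand side. *)
Lemma offact_skew D i a b :
  fixes_frame D -> cdot (offact D i a) b = - cdot a (offact D i b).
Proof.
move=> fixD; have [derD De] := fixD.
have := derE (X i a) (X i b) derD.
rewrite !offactE // !frameE linearZ linearD /= !De addr0 scaler0 -scalerDl.
move=> /esym/idem_sum_eq0/eqP; rewrite -mulrDr mulf_eq0 (negPf nz2) /=.
by rewrite addr_eq0 => /eqP.
Qed.

(* Triality: the action on one off-diagonal slot determines the other two. If
   it vanishes, the next one commutes with all left multiplications, hence is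
   a right multiplication by an element of the nucleus. *)
Lemma offact_eq0 D i : fixes_frame D -> (forall a, offact D i a = 0) -> D = 0.
Proof.
move=> fixD act0; have [derD De] := fixD.
have actM a b :
    offact D (S (S i)) (star (nmul a b)) = star (nmul a (offact D (S i) b)).
  apply: (@offdiag_inj (S (S i))).
  rewrite -offactE // -offdiag_offdiagS derE //.
  by rewrite !offactE // act0 linear0 jdot0l add0r offdiag_offdiagS.
have act2 b : offact D (S (S i)) (star b) = star (offact D (S i) b).
  by have := actM cone b; rewrite !cmul1l.
have act1M a b : offact D (S i) (nmul a b) = nmul a (offact D (S i) b).
  by apply: (can_inj (@starK _ O)); rewrite -act2 actM.
have act1E a : offact D (S i) a = nmul a (offact D (S i) cone).
  by rewrite -act1M cmul1r.
have act1_0 : offact D (S i) cone = 0.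
  apply: cnucleus => [|a b]; last by rewrite -!act1E act1M.
  (* Skewness makes the image of [cone] orthogonal to [cone], as 2 is invertible; this excludes the
     scalars of the nucleus. *)
  apply/eqP; have /eqP := offact_skew (S i) cone cone fixD.
  by rewrite (cdotC cone) -addr_eq0 -mulr2n -mulr_natl mulf_eq0 (negPf nz2).
have act1_all0 a : offact D (S i) a = 0 by rewrite act1E act1_0 nmul0r.
apply/lfunP; apply: (@frame_ind _ _ _ fr _ i) => [x y|k x||||b|b|b].
- by rewrite !linearD /= => -> ->.
- by rewrite !linearZ /= => ->.
all: rewrite zero_lfunE ?De // offactE // ?act0 ?act1_all0 ?linear0 //.
by rewrite -[b]starK act2 act1_all0 star0 linear0.
Qed.

(** Differentiating [idem_idem] gives this equation doubled. *)
Lemma der_idem D i : D \in der J -> jdot (e i) (D (e i)) = D (e i).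
Proof.
move=> derD; have := derE (e i) (e i) derD.
rewrite frameE linearD /= (jdotC fr (D _)) => /eqP.
rewrite -subr_eq0 opprD addrACA -mulr2n -scaler_nat scaler_eq0 (negPf nz2) /=.
by rewrite subr_eq0 => /eqP.
Qed.

(** [jdot (e i)] has eigenvalue 2 on [e i], 1 on slots i+1 and i+2, and 0 on the rest; by [der_idem]
    the image of [e i] has eigenvalue 1. *)
Lemma der_idem_offdiag D i : D \in der J ->
  D (e i) = X (S i) (offcoord fr (D (e i)) (S i))
            + X (S (S i)) (offcoord fr (D (e i)) (S (S i))).
Proof.
move=> derD; set z := D (e i); have ez : jdot (e i) z = z := der_idem i derD.
set w := RHS; have e_dec k : jdot (e i) (k *: e i + w) = (2 * k) *: e i + w.
  rewrite linearD linearZ linearD /= !frameE -mulr2n -scaler_nat scalerA.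
  by rewrite mulrC.
have zE : z = (2 * diagcoord fr z i) *: e i + w.
  rewrite -[LHS]ez -e_dec {1}(peirce_decomposition fr i z) /w.
  by rewrite !(linearD, linearZ) /= !frameE !scaler0 !addr0 !add0r.
have := ez; rewrite {1}zE e_dec [in RHS]zE => /addIr/eqP.
rewrite -subr_eq0 -scalerBl mulr_natl mulr2n addrK => /eqP e0.
by rewrite zE e0 add0r.
Qed.

(** [D (e j)] lives in slots j+1 and j+2. The hypothesis kills its part in slot j+2, and
    differentiating the zero product of [e (S (S j))] and [e j] kills the other. *)
Lemma fixes_frameP D : D \in der J ->
  (forall i, jdot (e (S i)) (jdot (e (S (S i))) (D (e (S i)))) = 0) ->
  fixes_frame D.
Proof.
move=> derD proj0.
pose p j := offcoord fr (D (e j)) (S j).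
have De j : D (e j) = X (S j) (p j).
  rewrite der_idem_offdiag // -[X in _ + X]offdiag_projection ordS3K.
  by have := proj0 (S (S j)); rewrite ordS3K => ->; rewrite addr0.
split=> // j; rewrite -(ordS3K j); set k := S (S j).
have := derE (e k) (e (S k)) derD.
by rewrite frameE !De !frameE linear0 add0r => /esym.
Qed.

Lemma der_decomposition D i : D \in der J ->
  exists D0 a b c, fixes_frame D0
    /\ D = D0 + (rotation fr i a + rotation fr (S i) b
                   + rotation fr (S (S i)) c).
Proof.
(* The sign comes from [rotation_idemS]: the rotation by [a] in slot [j] sends [e (S j)] to
   [- X j a]. *)
move=> derD; pose r j := - offcoord fr (D (e (S j))) j.
set R := rotation fr i (r i) + rotation fr (S i) (r (S i))
         + rotation fr (S (S i)) (r (S (S i))).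
exists (D - R), (r i), (r (S i)), (r (S (S i))); split; last by rewrite subrK.
apply: fixes_frameP => [|j].
  by rewrite rpredB // !rpredD ?rotation_der.
(* Slot j+1 rotations kill [e (S j)], and the contribution of slot j+2 is invisible to the
   projection onto slot [j]. *)
suff -> : (D - R) (e (S j))
        = D (e (S j)) + X j (r j) - X (S (S j)) (r (S (S j))).
  rewrite !(linearB (jdot _)) !(linearD (jdot _)) /= !frameE !linear0 addr0.
  by rewrite offdiag_projection -linearD subrr linear0.
rewrite add_lfunE opp_lfunE -addrA; congr (_ + _); apply/eqP; rewrite eqr_oppLR.
rewrite opprD opprK /R !add_lfunE.
apply/eqP; case: (ordS3P i j);
  rewrite ?ordS3K !(rotationsE, ordS3K, addr0, add0r) //; exact: addrC.
Qed.

End FrameDerivations.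

(** * Ideals *)

Section Ideals.
Variables (F : fieldType) (O : compAlg F) (J : nalg F) (fr : peirceFrame O J).
Hypotheses (nz2 : 2 != 0 :> F) (nz3 : 3 != 0 :> F).
Variable I : {vspace 'End(J)}.
Hypothesis subI : (I <= der J)%VS.
Hypothesis idealI :
  forall D E, D \in der J -> E \in I -> commutator D E \in I.
Local Notation S := (@ordS 3).
Local Notation e := (idem fr).
Local Notation X := (offdiag fr).
Local Notation R := (rotation fr).
Implicit Types (i j : 'I_3) (a b c u v w : O) (D E : 'End(J)).

(** Bracketing with [R i v] and then with [R i w] gives a combination of [R i u] and [R i v]; taking
    [w] not orthogonal to [u] makes the coefficient of [R i v] nonzero. *)
Lemma rotation_ideal_slot i u v : R i u \in I -> u != 0 -> R i v \in I.
Proof.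
move=> uI /cdot_nondegenerate[w nz_wu].
have nz4 : 4 != 0 :> F by rewrite (natrM _ 2 2) mulf_neq0.
have := idealI (rotation_der fr nz2 i w) (idealI (rotation_der fr nz2 i v) uI).
rewrite commutatorC commutator_fix_rotation //; last first.
  exact: commutator_rotations_fix.
rewrite offact_rotations // rpredN (linearB (R i)) !linearZ /=.
rewrite scalerN rpredBl; last exact: rpredZ.
by rewrite rpredZeq mulf_eq0 (negPf nz4) cdotC (negPf nz_wu).
Qed.

Lemma rotation_ideal_next i :
  (forall u, R i u \in I) -> forall u, R (S i) u \in I.
Proof.
move=> slotI u.
(* The unit rotation of slot i+2 carries slot [i] onto slot i+1, up to sign and conjugation. *)
have := idealI (rotation_der fr nz2 (S (S i)) cone) (slotI (star u)).
rewrite -[in R i _](ordS3K i) commutator_rotation_rotationS // ordS3K.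
by rewrite cmul1l starK rpredN.
Qed.

Lemma rotation_ideal i u : R i u \in I -> u != 0 -> forall j v, R j v \in I.
Proof.
move=> uI nz_u j v; have slotI w := rotation_ideal_slot w uI nz_u.
by case: (ordS3P i j); [ | | apply: rotation_ideal_next ];
  try apply: rotation_ideal_next.
Qed.

(* As the action d of D on a slot is skew, the sum of the [R i u, R i (d u)]
   over an orthonormal basis acts on that slot as 8 d. *)
Lemma fixes_frame_ideal D :
  (forall j v, R j v \in I) -> fixes_frame fr D -> D \in I.
Proof.
move=> RI fixD; pose i : 'I_3 := ord0; pose d := offact fr D i.
pose T := \sum_(u <- cbasis O) commutator (R i u) (R i (d u)).
have TI : T \in I.
  by apply: rpred_sum => u _; apply: idealI; rewrite ?rotation_der.
have fixT : fixes_frame fr T.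
  apply: big_ind => [|A B|u _]; [|exact: fixes_frameD|].
    by split=> [|j]; rewrite ?mem0v ?zero_lfunE.
  exact: commutator_rotations_fix.
have DX w : D (X i w) = X i (d w) by rewrite -offactE.
have TX w : T (X i w) = 4 *: D (X i w) + 4 *: D (X i w).
  rewrite [in LHS]sum_lfunE /= [in X in X + _]DX.
  rewrite -[in X in X + _](cbasis_expansion (d w)).
  rewrite -[in X in _ + X](cbasis_expansion w).
  rewrite !linear_sum /= -big_split /=; apply: eq_bigr => u _.
  rewrite (offactE nz2); last exact: commutator_rotations_fix.
  rewrite offact_rotations // /d (offact_skew nz2) // -/d mulrN scaleNr opprK.
  by rewrite linearD !linearZ /= DX !scalerA addrC !(mulrC 4).
have nz8 : 4 + 4 != 0 :> F.
  by rewrite -natrD (natrM _ 2 4) (natrM _ 2 2) !mulf_neq0.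
(* By triality two elements of D_0 that agree on one slot are equal. *)
have eqD : D = (4 + 4)^-1 *: T.
  apply/eqP; rewrite -subr_eq0; apply/eqP.
  have fixD' : fixes_frame fr (D - (4 + 4)^-1 *: T).
    apply: fixes_frameD => //; have [derT Te] := fixT.
    split=> [|j]; rewrite ?rpredN ?rpredZ // opp_lfunE scale_lfunE Te scaler0.
    exact: oppr0.
  apply: (offact_eq0 nz2 (i := i) fixD') => w; apply: (@offdiag_inj _ _ _ fr i).
  rewrite -offactE // add_lfunE opp_lfunE scale_lfunE TX -scalerDl scalerA.
  by rewrite mulVf // scale1r subrr linear0.
by rewrite eqD rpredZ.
Qed.

Definition peirce_filter i E :=
  commutator (R i cone) (commutator (R i cone) E) + E.

Lemma peirce_filterD i D E :
  peirce_filter i (D + E) = peirce_filter i D + peirce_filter i E.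
Proof. by rewrite /peirce_filter !commutatorDr addrACA. Qed.

Lemma peirce_filter_ideal i E : E \in I -> peirce_filter i E \in I.
Proof. by move=> EI; rewrite rpredD // !idealI ?rotation_der. Qed.

(** The inner bracket is a rotation in slot [i], and two rotations in the same slot have their
    bracket in D_0. *)
Lemma peirce_filter_fixes i D :
  fixes_frame fr D -> fixes_frame fr (peirce_filter i D).
Proof.
move=> fixD; apply: fixes_frameD => //.
rewrite (commutatorC _ D) commutator_fix_rotation // -linearN.
exact: commutator_rotations_fix.
Qed.

Lemma peirce_filterS i b : peirce_filter i (R (S i) b) = 0.
Proof.
rewrite /peirce_filter commutator_rotation_rotationS // commutatorNr.
by rewrite commutator_rotation_rotationSS // cmul1l cmul1r starK addNr.
Qed.

Lemma peirce_filterSS i b : peirce_filter i (R (S (S i)) b) = 0.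
Proof.
rewrite /peirce_filter commutator_rotation_rotationSS //.
by rewrite commutator_rotation_rotationS // cmul1l cmul1r starK addNr.
Qed.

Lemma peirce_filter_rotation i a :
  peirce_filter i (R i a) = R i ((4 * cdot cone a) *: cone - 3 *: a).
Proof.
rewrite /peirce_filter (commutatorC (R i cone) (commutator _ _)).
rewrite commutator_fix_rotation //; last exact: commutator_rotations_fix.
rewrite offact_rotations // cdot11 mulr1 (cdotC a) -linearN -linearD.
rewrite opprB -addrA; congr (R i (_ + _)).
by rewrite -!scaleNr -[X in _ + X]scale1r -scalerDl; congr (_ *: _); ring.
Qed.

(** The map is 1 on [cone] and -3 on its orthogonal complement, hence injective when 3 is
    invertible. *)
Lemma peirce_filter_neq0 a : (4 * cdot cone a) *: cone - 3 *: a = 0 -> a = 0.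
Proof.
move=> eq0; have := congr1 (cdot cone) eq0.
rewrite linearB !linearZ /= cdot11 mulr1 linear0 -mulrBl.
rewrite (_ : 4 - 3 = 1); last by ring.
rewrite mul1r => dot0; move: eq0; rewrite dot0 mulr0 scale0r sub0r => /eqP.
by rewrite oppr_eq0 scaler_eq0 (negPf nz3) => /eqP.
Qed.

(** An ideal not containing all derivations contains no nonzero rotation ([R0]). Every element is
    then shown to be zero by reducing its components to single rotations: first those in D_0
    ([fix0]), then D_0 plus one slot ([one0]), then the general case ([three0]). *)
Lemma ideal_alternative : I = 0%VS \/ (der J <= I)%VS.
Proof.
have [derI | proper] := boolP (der J <= I)%VS; [by right | left].
have R0 j u : R j u \in I -> u = 0.
  move=> uI; apply: contraNeq proper => nz_u; have RI := rotation_ideal uI nz_u.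
  apply/subvP=> D derD.
  have [D0 [a [b [c [fixD0 ->]]]]] :=
    der_decomposition fr nz2 (ord0 : 'I_3) derD.
  by rewrite rpredD ?(fixes_frame_ideal RI fixD0) // !rpredD ?RI.
have commI D E : D \in I -> E \in der J -> commutator D E \in I.
  by move=> DI derE; rewrite commutatorC rpredN idealI.
have filter0 j a : peirce_filter j (R j a) \in I -> a = 0.
  by rewrite peirce_filter_rotation => /R0/peirce_filter_neq0.
have fix0 D : fixes_frame fr D -> D \in I -> D = 0.
  move=> fixD DI; apply: (offact_eq0 nz2 (i := ord0) fixD) => v.
  apply: (R0 ord0).
  by rewrite -commutator_fix_rotation // commI ?rotation_der.
have one0 D i a : fixes_frame fr D -> D + R i a \in I -> a = 0.
  move=> fixD DI.
  (* Bracketing with slot i+1 removes the D_0 component and leaves slots i+1 and i+2; the filter of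
     slot i+1 then isolates the first. *)
  have comI b :
      R (S i) (offact fr D (S i) b) - R (S (S i)) (star (nmul a b)) \in I.
    rewrite -commutator_fix_rotation // -commutator_rotation_rotationS //.
    by rewrite -commutatorDl commI ?rotation_der.
  have act0 b : offact fr D (S i) b = 0.
    apply: (filter0 (S i)); have := peirce_filter_ideal (S i) (comI b).
    by rewrite -linearN peirce_filterD peirce_filterS addr0.
  have := comI cone; rewrite act0 linear0 sub0r rpredN => /R0.
  by rewrite cmul1r => /(congr1 star); rewrite starK star0.
have three0 D i a b c : fixes_frame fr D ->
    D + (R i a + R (S i) b + R (S (S i)) c) \in I -> a = 0.
  (* The filter erases slots i+1 and i+2 and keeps D_0 stable, which reduces to [one0]. *)
  move=> fixD /(peirce_filter_ideal i).
  rewrite !peirce_filterD peirce_filterS peirce_filterSS !addr0.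
  rewrite peirce_filter_rotation => /one0 a0; apply: peirce_filter_neq0.
  exact/a0/peirce_filter_fixes.
apply/eqP; rewrite -subv0; apply/subvP=> D DI.
have derD := subvP subI D DI.
have [D0 [a [b [c [fixD0 eqD]]]]] :=
  der_decomposition fr nz2 (ord0 : 'I_3) derD.
set i : 'I_3 := ord0 in eqD; move: DI; rewrite eqD => DI.
have a0 := three0 _ _ _ _ _ fixD0 DI.
move: DI; rewrite a0 linear0 add0r => DI.
(* The same argument with base index i+1, where the third slot is now [i] and carries 0. *)
have b0 : b = 0.
  by apply: (three0 D0 (S i) b c 0 fixD0); rewrite linear0 addr0.
move: DI; rewrite b0 linear0 add0r => DI.
have c0 : c = 0 := one0 _ _ _ fixD0 DI.
move: DI; rewrite c0 linear0 addr0 => /(fix0 _ fixD0) ->.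
exact: mem0v.
Qed.

End Ideals.

(** * Transfer to the Lie algebra [Der J] and conclusion *)

Section Simplicity.
Variables (F : fieldType) (O : compAlg F) (J : nalg F) (fr : peirceFrame O J).
Hypotheses (nz2 : 2 != 0 :> F) (nz3 : 3 != 0 :> F).

Lemma commutator_rotation_neq0 i :
  commutator (rotation fr i cone) (rotation fr (ordS i) cone) != 0.
Proof.
rewrite commutator_rotation_rotationS // cmul1l star_cone oppr_eq0.
apply: contra_neq (cone_neq0 O) => rot0; set j := ordS (ordS i) in rot0.
apply: (@offdiag_inj _ _ _ fr j).
by rewrite -rotation_idemSS rot0 zero_lfunE linear0.
Qed.

Lemma Der_simple : lie_simple (Der J).
Proof.
split=> [|I idealI].
  exists (Subvs (rotation_der fr nz2 ord0 cone)).
  exists (Subvs (rotation_der fr nz2 (ordS ord0) cone)).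
  apply: contraNneq (commutator_rotation_neq0 ord0) => eq0.
  by have /(congr1 vsval) := eq0; rewrite linear0 => /= ->.
(* An ideal of [Der J] lies in a subspace type; its image among endomorphisms is what
   [ideal_alternative] handles. *)
pose J0 : {vspace 'End(J)} := (linfun vsval @: I)%VS.
have memJ0 (D : subvs_of (der J)) : (vsval D \in J0) = (D \in I).
  apply/memv_imgP/idP => [[E EI]|DI]; last by exists D; rewrite ?lfunE.
  by rewrite lfunE /= => /val_inj->.
have subJ0 : (J0 <= der J)%VS.
  by apply/subvP=> _ /memv_imgP[D _ ->]; rewrite lfunE; apply: subvsP.
have idealJ0 D E : D \in der J -> E \in J0 -> commutator D E \in J0.
  move=> derD /memv_imgP[E' E'I ->]; rewrite lfunE /=.
  by have := idealI (Subvs derD) _ E'I; rewrite -memJ0.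
have [J0_0|derJ0] := ideal_alternative fr nz2 nz3 subJ0 idealJ0; [left|right].
  apply/eqP; rewrite -subv0; apply/subvP=> D; rewrite -memJ0 J0_0 !memv0.
  by move=> /eqP D0; apply/eqP/val_inj.
apply/eqP; rewrite eqEsubv subvf; apply/subvP=> D _.
by rewrite -memJ0 (subvP derJ0) ?subvsP.
Qed.

End Simplicity.

Definition octonion_compAlg (F : fieldType) (nz2 : 2 != 0 :> F) : compAlg F :=
  @CompAlg F (octonion F) (oct1 F) (@odot F) (oct_basis F)
    (@oct_mul1l F) (@oct_mul1r F) (star_oct1 F) (@odotC F) (@odot_linear F)
    (odot11 F) (@odot_star F) (@odot_cycle F) (@oct_mul_starr F)
    (@oct_alternative_l F) (@oct_alternative_r F)
    (fun a => @oct_star_fixed F a nz2) (@oct_basis_expansion F)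
    (fun t => @oct_nucleus_r F t nz2).

Theorem theorem2p10 (F : closedFieldType) (charF0 : [pchar F] =i pred0) :
  lie_simple (Der (jordan_type_D F)).
Proof.
(* With the shift, [nz 1] and [nz 2] state that 2 and 3 are nonzero in [F]. *)
have nz n : n.+1%:R != 0 :> F by rewrite ((pcharf0P F).1 charF0).
pose fr := hermitian_frame (octonion_compAlg (nz 1)) (nz 1).
exact: (Der_simple fr (nz 1) (nz 2)).
Qed.
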